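(* Let $n=p_1p_2\cdots p_\ell$ ($\ell\ge1$) be a product of distinct odd primes. Then $$\Psi^w_{\mathbb{Z}_n}(x)=\frac{1}{\phi(n)}\sum_{(d_1,\dots,d_\ell)}\left(\prod_{i=1}^{\ell}\phi\!\left(\frac{p_i-1}{d_i}\right)\right)\sum_{I\subseteq\{1,\dots,\ell\}}(-1)^{|I|}F_I(d_1,\dots,d_\ell),$$ where $(d_1,\dots,d_\ell)$ runs over all tuples with $d_i\mid p_i-1$ for each $i$.
   Context: $\phi$ is Euler's totient function. Given $d_i\mid p_i-1$ ($i=1,\dots,\ell$) and a nonempty $J\subseteq\{1,\dots,\ell\}$, let $L_J=\mathrm{lcm}\{(p_i-1)/d_i: i\in J\}$, $P_J=\prod_{i\in J}(p_i-1)$, and let $\alpha_J=L_J$ if there is an integer $c$ with $c\,d_i\equiv\frac{p_i-1}{2}\pmod{p_i-1}$ for all $i\in J$, and $\alpha_J=2L_J$ otherwise. (For $|J|=1$, $J=\{i\}$, this gives $\alpha_J=(p_i-1)/\gcd(d_i,\frac{p_i-1}{2})$.) Put $f_J(x)=\left(1+x^{\alpha_J}\right)^{P_J/\alpha_J}$. For $I\subseteq\{1,\dots,\ell\}$ define $F_I(d_1,\dots,d_\ell)=\prod_{\emptyset\ne J\subseteq\{1,\dots,\ell\}\setminus I}f_J(x)$ (so $F_{\{1,\dots,\ell\}}=1$). For a finite group $\mathcal{A}$ with identity $e$, let $G(\mathcal{A})=\{\Omega\subseteq\mathcal{A}:\Omega^{-1}=\Omega,\ \langle\Omega\rangle=\mathcal{A},\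 e\notin\Omega\}$; for $k\ge1$ let $a^w_k(\mathcal{A})$ be the number of orbits of $\mathrm{Aut}(\mathcal{A})$ (acting by $\alpha\cdot\Omega=\alpha(\Omega)$) on $\{\Omega\in G(\mathcal{A}):|\Omega|=k\}$ (the number of weak equivalence classes of Cayley graphs of $\mathcal{A}$ of degree $k$), and $\Psi^w_{\mathcal{A}}(x)=\sum_{k=1}^{|\mathcal{A}|-1}a^w_k(\mathcal{A})x^k$. *)

(* Defs.v *)
From HB Require Import structures.
From mathcomp Require Import all_boot all_order all_algebra all_fingroup.
From Stdlib Require Import ClassicalEpsilon.
Set Implicit Arguments. Unset Strict Implicit. Unset Printing Implicit Defensive.
Import GRing.Theory.

Definition cayley_sets (gT : finGroupType) (k : nat) : {set {set gT}} :=
  [set Om : {set gT} | [&& (Om^-1)%g == Om, <<Om>>%g == [set: gT],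
                         (1%g : gT) \notin Om & #|Om| == k]].

Definition aw (gT : finGroupType) (k : nat) : nat :=
  #|[set orbit 'P^* (Aut [set: gT]) Om | Om in cayley_sets gT k]|.

Definition Psi_w (gT : finGroupType) : {poly rat} :=
  (\sum_(1 <= k < #|gT|) (aw gT k)%:R *: 'X^k)%R.

Section RHS.
Variables (l : nat) (p : 'I_l -> nat) (d : 'I_l -> nat).

Definition L_J (J : {set 'I_l}) : nat := \big[lcmn/1%N]_(i in J) ((p i).-1 %/ d i).
Definition P_J (J : {set 'I_l}) : nat := \prod_(i in J) (p i).-1.

Definition alpha_J (J : {set 'I_l}) : nat :=
  if excluded_middle_informative
       (exists c : int, forall i, i \in J ->
          ((c * (d i)%:Z)%R = ((p i).-1 %/ 2)%:Z %[mod ((p i).-1)%:Z])%Z)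
  then L_J J else 2 * L_J J.

Definition f_J (J : {set 'I_l}) : {poly rat} :=
  ((1 + 'X^(alpha_J J)) ^+ (P_J J %/ alpha_J J))%R.

Definition F_I (I : {set 'I_l}) : {poly rat} :=
  (\prod_(J : {set 'I_l} | (J != set0) && (J \subset ~: I)) f_J J)%R.

End RHS.

(* Main.v *)
(* By Burnside's lemma, phi(n) Psi^w is the sum, over the automorphisms x |-> u x of
   Z_n, of the generating functions of the connection sets they fix. Such a set is a
   union of orbits of the group generated by u and -1. If u has order (p_i - 1)/d_i
   modulo p_i, the size of the orbit of x depends only on the set J of the i with
   x <> 0 modulo p_i: there are L_J elements u^k x, and adjoining -1 doubles this number
   unless -1 is a power of u simultaneously modulo all p_i with i in J; the orbit has
   alpha_J elements. Hence F_I is the generating function of the invariant sets of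
   nonzero elements that vanish modulo p_i for all i in I, and inclusion-exclusion over
   I singles out the generating sets. By the Chinese remainder theorem,
   prod_i phi((p_i - 1)/d_i) units u have the prescribed orders. *)
Require Import Defs.
From HB Require Import structures.
From mathcomp Require Import all_boot all_order all_algebra all_fingroup.
From mathcomp Require Import cyclic finfield zify.
From Stdlib Require Import ClassicalEpsilon.
Set Implicit Arguments. Unset Strict Implicit. Unset Printing Implicit Defensive.
Import GRing.Theory.
Local Open Scope ring_scope.

(** * Generating functions of invariant sets *)

Lemma prod_1D_subset (R : comNzRingType) (T : finType) (A : {set T}) (F : T -> R) :
  \prod_(i in A) (1 + F i) = \sum_(I : {set T} | I \subset A) \prod_(i in I) F i.
Proof.
(* Extending [F] by zero outside [A] lets distributivity run over the whole type; subsets not inside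
   [A] then contribute zero. *)
pose F' i := if i \in A then F i else 0.
transitivity (\prod_i (F' i + 1)).
  rewrite big_mkcond; apply: eq_bigr => i _; rewrite /F'.
  by case: ifP; rewrite ?add0r // addrC.
rewrite bigA_distr [RHS]big_mkcond; apply: eq_bigr => I _.
rewrite -big_mkcond; case: ifP => [/subsetP sIA | /negbT/subsetPn[i Ii nAi]].
  by apply: eq_bigr => i /sIA Ai; rewrite /F' Ai.
by rewrite (bigD1 i) //= /F' (negPf nAi) mul0r.
Qed.

(** Expand the power of 1 - 1 with exponent the size of [A]; this is the source of the
    inclusion-exclusion signs. *)
Lemma sum_sign_subset (R : comNzRingType) (T : finType) (A : {set T}) :
  \sum_(I : {set T} | I \subset A) (-1) ^+ #|I| = (A == set0)%:R :> R.
Proof.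
transitivity (\prod_(i in A) (1 + (-1)) : R).
  by rewrite prod_1D_subset; apply: eq_bigr => I _; rewrite prodr_const.
by rewrite prodr_const addrN expr0n cards_eq0; case: eqP.
Qed.

(** An invariant set amounts to a choice of orbits. These are disjoint, so sizes add up and the
    expanded product runs over all choices. *)
Lemma sum_invariant_sets (R : comNzRingType) (aT : finGroupType) (rT : finType)
    (to : {action aT &-> rT}) (G : {group aT}) (S : {set rT}) (x : R) :
    [acts G, on S | to] ->
  \sum_(A : {set rT} | (A \subset S) && (G \subset 'N(A | to)%g)) x ^+ #|A|
    = \prod_(O in orbit to G @: S) (1 + x ^+ #|O|).
Proof.
move=> GactS; rewrite prod_1D_subset.
have tiP (Q : {set {set rT}}) : Q \subset orbit to G @: S -> trivIset Q.
  move=> sQ; have /and3P[_ tiS _] := orbit_partition GactS.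
  exact: trivIsetS sQ tiS.
have coverK (Q : {set {set rT}}) : Q \subset orbit to G @: S -> orbit to G @: cover Q = Q.
  move=> /subsetP sQ; apply/setP=> O; apply/imsetP/idP.
    case=> y /bigcupP[B QB By] ->; have /imsetP[z Sz defB] := sQ B QB.
    by move: By; rewrite {1}defB => /orbit_in_eqP; rewrite -defB => -> //; apply/subsetT.
  move=> QO; have /imsetP[z Sz defO] := sQ O QO; exists z => //.
  by apply/bigcupP; exists O => //; rewrite defO orbit_refl.
(* Taking the union of a set of orbits and taking the orbits of an invariant set are mutually
   inverse. *)
rewrite (reindex_onto (fun Q : {set {set rT}} => cover Q)
                      (fun A : {set rT} => orbit to G @: A)) /=.
  apply: eq_big => [Q | Q]; last first.
    move=> /andP[/andP[sQ _] /eqP eQ].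
    rewrite prodrXr; congr (_ ^+ _); apply/esym/eqP.
    by apply: tiP; rewrite -eQ; apply: imsetS.
  apply/idP/idP=> [/andP[/andP[sQ _] /eqP eQ] | sQ].
    by rewrite -eQ; apply: imsetS.
  rewrite coverK // eqxx andbT; apply/andP; split.
    apply/bigcupsP=> B QB; have /imsetP[z Sz ->] := subsetP sQ B QB.
    by rewrite acts_sub_orbit.
  apply/subsetP=> g Gg; apply/astabsP=> y.
  apply/bigcupP/bigcupP=> [[B QB yB]|[B QB yB]]; exists B => //;
    have /imsetP[z Sz defB] := subsetP sQ B QB; move: yB; rewrite defB;
    by rewrite orbit_actr.
move=> A /andP[sAS nA]; apply/setP=> y; apply/bigcupP/idP.
  case=> _ /imsetP[z Az ->]; apply/subsetP; by rewrite acts_sub_orbit.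
by move=> Ay; exists (orbit to G y); rewrite ?orbit_refl ?imset_f.
Qed.

(** Each fibre of the invariant [f] splits into orbits of equal size [alpha j], so their number is a
    quotient. *)
Lemma prod_orbits (R : comNzRingType) (aT : finGroupType) (rT I : finType)
    (to : {action aT &-> rT}) (G : {group aT}) (f : rT -> I) (alpha : I -> nat)
    (P : pred I) (x : R) :
    (forall g y, g \in G -> f (to y g) = f y) ->
    (forall y, #|orbit to G y| = alpha (f y)) ->
  \prod_(O in orbit to G @: [set y | P (f y)]) (1 + x ^+ #|O|)
    = \prod_(j | P j) (1 + x ^+ alpha j) ^+ (#|[set y | f y == j]| %/ alpha j).
Proof.
move=> fG card_orb.
have fO y z : z \in orbit to G y -> f z = f y by case/orbitP=> g Gg <-; apply: fG.
have [y0 _ | no_y] := pickP rT; last first.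
  rewrite big1 => [|O /imsetP[y]]; last by have := no_y y.
  rewrite big1 // => j _; rewrite (_ : [set y | f y == j] = set0) ?cards0 ?div0n //.
  by apply/setP=> y; have := no_y y.
(* The common value of [f] on an orbit; the default [y0] never matters, since orbits are
   nonempty. *)
pose h (O : {set rT}) := f (odflt y0 [pick y in O]).
have hO y : h (orbit to G y) = f y.
  rewrite /h; case: pickP => [z /fO // | /(_ y)]; by rewrite orbit_refl.
rewrite (partition_big h P) => [|O /imsetP[y]]; last by rewrite inE => Py ->; rewrite hO.
apply: eq_bigr => j Pj.
have GactS : [acts G, on [set y | f y == j] | to].
  by apply/subsetP=> g Gg; apply/astabsP=> y; rewrite !inE fG.
have fiber O : (O \in orbit to G @: [set y | P (f y)]) && (h O == j)
             = (O \in orbit to G @: [set y | f y == j]).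
  apply/andP/imsetP=> [[/imsetP[y _ ->]] | [y]].
    by rewrite hO => /eqP fy; exists y; rewrite // inE fy.
  rewrite inE => /eqP fy ->; split; last by rewrite hO fy.
  by apply: imset_f; rewrite inE fy.
rewrite (eq_bigl _ _ fiber).
have cardO O : O \in orbit to G @: [set y | f y == j] -> #|O| = alpha j.
  by case/imsetP=> y; rewrite inE => /eqP <- ->.
under eq_bigr => O QO do rewrite (cardO O QO).
rewrite prodr_const; congr (_ ^+ _).
rewrite -(acts_sum_card_orbit GactS) (eq_bigr (fun=> alpha j) cardO) sum_nat_const.
(* If [alpha j] is 0, the fibre is empty, because orbits are nonempty. *)
have [a0 | a0] := posnP (alpha j); last by rewrite mulnK.
rewrite a0 muln0 div0n; apply/eqP; rewrite cards_eq0 imset_eq0; apply/eqP/setP=> y.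
rewrite !inE; apply/eqP => fy; have := card_orb y; rewrite fy a0 => /eqP.
by rewrite cards_eq0 => /eqP/setP/(_ y); rewrite orbit_refl inE.
Qed.

(** * Roots of unity *)

Local Open Scope nat_scope.

(** The multiplicative group is cyclic, so some [z] has order [m], and the elements of order [m] are
    the powers of [z] with exponent coprime to [m]. *)
Lemma card_prim_root (F : finFieldType) (m : nat) :
  m %| #|F|.-1 -> #|[set y : F | m.-primitive_root y]| = totient m.
Proof.
move=> dvm.
have F1 : 0 < #|F|.-1 by have := finNzRing_gt1 F; case: #|F| => [|[]].
have m0 : 0 < m by case: m dvm => //; rewrite dvd0n => /eqP h; rewrite h in F1.
have [g gP] : exists g : F, (#|F|.-1).-primitive_root g.
  have /hasP[g _ gP] : has (#|F|.-1).-primitive_root (enum [pred x : F | x != 0%R]).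
    apply: has_prim_root => //; last by rewrite -cardE (cardC1 (0%R : F)).
      apply/allP=> x; rewrite mem_enum inE => nz_x; rewrite unity_rootE.
      apply/eqP/(mulfI nz_x); rewrite -exprS mulr1 prednK ?expf_card //.
      exact: ltnW (finNzRing_gt1 F).
    exact: enum_uniq.
  by exists g.
have zP := dvdn_prim_root gP dvm; set z := (g ^+ _)%R in zP.
transitivity #|[set (z ^+ (k : 'I_m))%R | k : 'I_m in [pred k : 'I_m | coprime m k]]|.
  apply: eq_card => y; rewrite inE; apply/idP/imsetP.
    move=> yP; have [k defy] := prim_rootP zP (prim_expr_order yP).
    exists k => //; rewrite inE coprime_sym.
    by rewrite -(prim_root_exp_coprime _ zP) -defy.
  by case=> k; rewrite inE coprime_sym => ck ->; rewrite prim_root_exp_coprime.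
rewrite card_in_imset; last first.
  move=> i j _ _ /eqP; rewrite (eq_prim_root_expr zP) => /eqP.
  by rewrite !modn_small // => /val_inj.
by rewrite totient_count_coprime big_mkord -big_mkcond sum1_card.
Qed.

(** In a field with 2 nonzero, -1 is the only square root of 1 other than 1. Hence the left side
    says that [q] divides [2 * c * d] but not [c * d]. *)
Lemma prim_root_exprN1 (F : fieldType) (q d m c : nat) (v : F) :
    odd q.+1 -> 0 < q -> m * d = q -> (2%:R != 0 :> F)%R -> m.-primitive_root v ->
  (v ^+ c == -1)%R = (c * d == q %/ 2 %[mod q]).
Proof.
move=> q2 q0 mdq F2 vP; pose h := q %/ 2.
have qE : q = h * 2 by rewrite /h; lia.
have h0 : 0 < h by lia.
have d0 : 0 < d by case: d mdq => //; lia.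
have dvm k : (v ^+ k == 1)%R = (q %| k * d).
  by rewrite -(prim_order_dvd vP) -mdq dvdn_pmul2r.
have -> : (v ^+ c == -1)%R = (v ^+ (c * 2) == 1)%R && (v ^+ c != 1)%R.
  rewrite exprM sqrf_eq1.
  have [-> | _] := eqVneq (v ^+ c)%R 1%R; rewrite ?eqxx ?andbF ?andbT //=.
  by apply: contraNF F2; rewrite -subr_eq0 opprK.
rewrite -/h !dvm. rewrite mulnAC {1}qE dvdn_pmul2r //.
apply/andP/eqP => [[/dvdnP[e ->] ] | e].
  rewrite qE [e * h]mulnC dvdn_pmul2l // dvdn2 negbK => oe.
  rewrite -[e]odd_double_half oe mulnDr muln1 -muln2 [_./2 * 2]mulnC mulnA.
  by rewrite addnC [_ * _./2]mulnC modnMDl.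
have cE : c * d = (c * d) %/ q * q + h.
  by rewrite {1}(divn_eq (c * d) q) e [h %% q]modn_small // qE; lia.
split; first by rewrite cE dvdn_addr // dvdn_mull // qE dvdn_mulr.
rewrite cE dvdn_addr ?dvdn_mull //; apply/negP => /dvdn_leq; lia.
Qed.

(** The cycle length [m] is a multiple of [L]; if [L < m], the iterate of index [L] would repeat [x]
    among the first [m] iterates, which are distinct. *)
Lemma card_porbit_order (T : finType) (s : {perm T}) (x : T) (L : nat) :
  0 < L -> (forall k, ((s ^+ k)%g x == x) = (L %| k)) -> #|porbit s x| = L.
Proof.
move=> L0 sL; set m := #|_|.
have Lm : L %| m by rewrite -sL permX iter_porbit.
have m0 : 0 < m by rewrite lt0n card_porbit_neq0.
apply/eqP; rewrite eqn_leq (dvdn_leq m0 Lm) andbT leqNgt; apply/negP=> ltLm.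
have := uniq_traject_porbit s x; move/(nth_uniq x) => /(_ 0 L).
rewrite size_traject m0 ltLm !nth_traject // => /(_ isT isT) /=.
by rewrite -permX eq_sym sL dvdnn => /esym/eqP L_0; rewrite -L_0 in L0.
Qed.
Local Open Scope ring_scope.

(** * The ring Z_n for squarefree n *)

Section SquarefreeResidues.
Variables (l : nat) (p : 'I_l -> nat).
Hypotheses (p_prime : forall i, prime (p i)) (p_inj : injective p) (l_gt0 : (0 < l)%N).
Local Notation n := (\prod_(i < l) p i)%N.

Definition residue (i : 'I_l) (x : 'Z_n) : 'F_(p i) := (x : nat)%:R.

Lemma prime_dvd_prod (i : 'I_l) : (p i %| n)%N.
Proof. by rewrite (bigD1 i) //= dvdn_mulr. Qed.

Lemma prod_prime_gt0 : (0 < n)%N.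
Proof. by rewrite prodn_gt0 // => i; apply: prime_gt0. Qed.

Lemma prod_prime_gt1 : (1 < n)%N.
Proof.
apply: leq_trans (prime_gt1 (p_prime (Ordinal l_gt0))) _.
exact: dvdn_leq prod_prime_gt0 (prime_dvd_prod _).
Qed.

(** Distinct primes are coprime, so the factors can be collected by induction on a duplicate-free
    list of indices. *)
Lemma prod_dvdn (k : nat) : (n %| k)%N = [forall i, p i %| k]%N.
Proof.
apply/idP/forallP=> [nk i | pk]; first exact: dvdn_trans (prime_dvd_prod i) nk.
have: uniq (index_enum 'I_l) by rewrite index_enum_uniq.
elim: (index_enum _) => [_|i s IHs] /=; first by rewrite big_nil dvd1n.
case/andP=> nis us; rewrite big_cons Gauss_dvd ?pk ?IHs //.
rewrite coprime_sym; elim: s nis {us IHs} => [|j s IHs]; rewrite ?big_nil ?coprime1n //.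
rewrite inE negb_or big_cons => /andP[neq_ij /IHs c]; rewrite coprimeMl c andbT.
by rewrite prime_coprime // dvdn_prime2 // (inj_eq p_inj) eq_sym.
Qed.

(** Since [p i] divides n, reducing modulo n first changes nothing. Compatibility with the ring
    operations follows from this. *)
Lemma residue_nat i k : residue i k%:R = k%:R.
Proof.
rewrite /residue val_Zp_nat ?prod_prime_gt1 // -[LHS]Fp_nat_mod //.
by rewrite modn_dvdm ?prime_dvd_prod // Fp_nat_mod.
Qed.

Lemma residueM i x y : residue i (x * y) = residue i x * residue i y.
Proof. by rewrite -[x]natr_Zp -[y]natr_Zp -natrM !residue_nat natrM. Qed.

Lemma residueD i x y : residue i (x + y) = residue i x + residue i y.
Proof. by rewrite -[x]natr_Zp -[y]natr_Zp -natrD !residue_nat natrD. Qed.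

Lemma residue0 i : residue i 0 = 0.
Proof. exact: (residue_nat i 0). Qed.

Lemma residue1 i : residue i 1 = 1.
Proof. exact: (residue_nat i 1). Qed.

Lemma residueN i x : residue i (- x) = - residue i x.
Proof. by apply: (addrI (residue i x)); rewrite -residueD !subrr residue0. Qed.

Lemma residueX i x k : residue i (x ^+ k) = residue i x ^+ k.
Proof. by elim: k => [|k IHk]; rewrite ?residue1 // !exprS residueM IHk. Qed.

Lemma residue_eq0 i x : (residue i x == 0) = (p i %| x)%N.
Proof. by rewrite -(dvdn_pcharf (pchar_Fp (p_prime i))). Qed.

(** The difference is divisible by n, while its representative lies below n. *)
Lemma residue_inj x y : (forall i, residue i x = residue i y) -> x = y.
Proof.
move=> eq_xy; apply/eqP; rewrite -subr_eq0; set z := x - y.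
have: (n %| z)%N.
  by rewrite prod_dvdn; apply/forallP=> i; rewrite -residue_eq0 residueD residueN eq_xy subrr.
have zn : (z < n)%N by apply: leq_trans (ltn_ord z) _; rewrite Zp_cast ?prod_prime_gt1.
have [z0 | z0] := posnP z; first by move=> _; apply/eqP/val_inj.
by move=> /(dvdn_leq z0); rewrite leqNgt zn.
Qed.

(** Chinese remainder theorem in counting form: the residue map into the product of the fields is
    injective between sets of equal size, hence bijective. *)
Lemma card_residues (Q : forall i, pred 'F_(p i)) :
  #|[set x : 'Z_n | [forall i, Q i (residue i x)]]| = (\prod_i #|Q i|)%N.
Proof.
pose rT (i : 'I_l) : finType := 'F_(p i).
pose rho (x : 'Z_n) : {dffun forall i, rT i} := [ffun i => residue i x].
have rho_inj : injective rho.
  by move=> x y /ffunP eq_xy; apply: residue_inj => i; have := eq_xy i; rewrite !ffunE.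
have card_ffun : #|{dffun forall i, rT i}| = #|'Z_n|.
  rewrite card_dep_ffun foldrE big_map card_ord Zp_cast ?prod_prime_gt1 // big_enum /=.
  by apply: eq_bigr => i _; rewrite card_Fp.
have [rho' rhoK rho'K] := inj_card_bij rho_inj (eq_leq card_ffun).
have := card_family (rT := rT) Q; rewrite foldrE big_map big_enum /= => <-.
rewrite -(card_imset _ rho_inj); apply: eq_card => f; apply/imsetP/familyP.
  by case=> x; rewrite inE => /forallP Qx -> i; rewrite ffunE; apply: Qx.
move=> Qf; exists (rho' f); rewrite ?rho'K // inE; apply/forallP => i.
by have := Qf i; rewrite -{1}[f]rho'K ffunE.
Qed.

(** The maximal subgroups are the sets of multiples of the [p i], so [Om] generates unless one of
    them contains it. *)
Lemma generatesP (Om : {set 'Z_n}) :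
  (<<Om>>%g == [set: 'Z_n]) = [forall i, exists x in Om, residue i x != 0].
Proof.
have n0 := prod_prime_gt0; have n1 := prod_prime_gt1.
(* The group is written multiplicatively: the multiples of [p i] are the elements killed by n /
   p_i. *)
have pow1 (i : 'I_l) (x : 'Z_n) : (x ^+ (n %/ p i) == 1)%g = (residue i x == 0).
  rewrite residue_eq0 -[x in LHS]natr_Zp FinRing.zmodXgE -mulrnA.
  rewrite -val_eqE /= val_Zp_nat // -[(_ %% _ == 0)%N]/(n %| _)%N.
  rewrite -{1}(divnK (prime_dvd_prod i)) mulnC dvdn_pmul2r //.
  by rewrite divn_gt0 ?prime_gt0 // dvdn_leq // prime_dvd_prod.
apply/eqP/forallP=> [genOm i | pOm].
  apply/existsP; case: (pickP [pred x | (x \in Om) && (residue i x != 0)]) => [x ? | nOm].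
    by exists x.
  pose K := [set x : 'Z_n | (x ^+ (n %/ p i) == 1)%g].
  have gK : group_set K.
    apply/group_setP; split=> [|x y]; rewrite !inE ?expg1n // => /eqP hx /eqP hy.
    by rewrite expgMn ?hx ?hy ?mulg1 //; apply: Zp_mulgC.
  have: <<Om>>%g \subset Group gK.
    rewrite gen_subG; apply/subsetP => x Omx; rewrite inE pow1.
    by have := nOm x; rewrite /= Omx; case: eqP.
  rewrite genOm => /subsetP/(_ (1%R : 'Z_n) (in_setT _)).
  by rewrite inE pow1 residue1 oner_eq0.
apply/eqP; rewrite eqEcard subsetT cardsT leqNgt; apply/negP=> ltOm.
have cZ : #|'Z_n| = n by rewrite card_ord Zp_cast.
rewrite cZ in ltOm.
have dvOm : (#|<<Om>>%g| %| n)%N.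
  by apply: dvdn_trans (cardSg (subsetT _)) _; rewrite cardsT cZ.
set m := #|_| in ltOm dvOm.
(* A prime dividing the index of the generated subgroup is some [p r]; then the order [m] divides n
   / p_r, so all of [Om] vanishes modulo [p r]. *)
have [r rq] : exists i, (p i %| n %/ m)%N.
  have q1 : (1 < n %/ m)%N by rewrite ltn_divRL ?mul1n.
  have := pdiv_dvd (n %/ m); have := pdiv_prime q1.
  move: (pdiv _) => r r_pr rq; have: (r %| n)%N.
    by apply: dvdn_trans rq _; apply/dvdnP; exists m; rewrite mulnC divnK.
  rewrite Euclid_dvd_prod // big_orE => /existsP[i]; rewrite /= dvdn_prime2 // => /eqP re.
  by exists i; rewrite -re.
have /existsP[x /andP[Omx]] := pOm r; case/negP; rewrite -pow1.
rewrite -order_dvdn; apply: dvdn_trans (_ : (m %| _)%N).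
  by rewrite order_dvdG // mem_gen.
have /dvdnP[k nm] := rq.
by rewrite -{1}(divnK dvOm) nm mulnAC mulnK ?prime_gt0 // dvdn_mull.
Qed.

(** * Supports: the primes at which an element is nonzero *)

Definition support (x : 'Z_n) : {set 'I_l} := [set i | residue i x != 0].

Lemma support_eq0 x : (support x == set0) = (x == 0).
Proof.
apply/eqP/eqP => [sx | ->]; last by apply/setP=> i; rewrite !inE residue0 eqxx.
apply: residue_inj => i; rewrite residue0; apply/eqP.
by have := in_set0 i; rewrite -sx inE => /negbFE.
Qed.

(** Coordinates in [J] take the nonzero residues, all others only 0. *)
Lemma card_support J : #|[set x | support x == J]| = P_J p J.
Proof.
pose Q i : pred 'F_(p i) := [pred y | (y != 0) == (i \in J)].
transitivity #|[set x : 'Z_n | [forall i, Q i (residue i x)]]|.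
  apply: eq_card => x; rewrite !inE; apply/eqP/forallP=> [sx i|sx].
    by rewrite /Q /= -sx inE eqxx.
  by apply/setP=> i; have := sx i; rewrite inE => /eqP.
rewrite card_residues /P_J [RHS]big_mkcond; apply: eq_bigr => i _.
have := cardC1 (0 : 'F_(p i)); rewrite card_Fp // => c0.
case: ifP => Ji.
  by rewrite -c0; apply: eq_card => y; rewrite !inE /= Ji eqb_id.
by rewrite -(card1 (0 : 'F_(p i))); apply: eq_card => y; rewrite !inE /= Ji eqbF_neg negbK.
Qed.

Lemma support_mul_unit x u : (forall i, residue i u != 0) -> support (x * u) = support x.
Proof. by move=> u0; apply/setP=> i; rewrite !inE residueM mulf_eq0 (negPf (u0 i)) orbF. Qed.

(** * Automorphisms as multiplications by units *)

Lemma Aut_mulr (a : {perm 'Z_n}) (x : 'Z_n) : a \in Aut [set: 'Z_n] -> a x = x * a 1.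
Proof.
move=> Aa.
have: a ((1%R : 'Z_n) ^+ x)%g = (a (1%R : 'Z_n) ^+ x)%g :=
  morphX (autm_morphism Aa) x (in_setT (1%R : 'Z_n)).
by rewrite !FinRing.zmodXgE natr_Zp => ->; rewrite -mulr_natl natr_Zp.
Qed.

Lemma residue_Aut_neq0 (a : {perm 'Z_n}) i : a \in Aut [set: 'Z_n] -> residue i (a 1) != 0.
Proof.
move=> Aa; have := Aut_mulr ((a^-1)%g 1) Aa; rewrite permKV => e1.
by apply/eqP=> r0; have := oner_neq0 'F_(p i); rewrite -(residue1 i) e1 residueM r0 mulr0 eqxx.
Qed.

Lemma Aut_expr (a : {perm 'Z_n}) k x : a \in Aut [set: 'Z_n] -> (a ^+ k)%g x = x * a 1 ^+ k.
Proof.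
move=> Aa; elim: k => [|k IHk]; first by rewrite perm1 mulr1.
by rewrite expgSr permM IHk Aut_mulr // exprSr mulrA.
Qed.

(** * The group generated by an automorphism and negation *)

Definition opp_perm : {perm 'Z_n} := perm (@oppr_inj 'Z_n).

Definition pm_group (a : {perm 'Z_n}) : {group {perm 'Z_n}} := (<[a]> <*> <[opp_perm]>)%G.

Lemma opp_permE x : opp_perm x = - x. Proof. exact: permE. Qed.

(** Invariance need only be tested on the two generators. It merges closure under inverses and being
    fixed by [a] into one group action. *)
Lemma pm_group_acts a (Om : {set 'Z_n}) :
  [acts pm_group a, on Om | 'P] = ((Om^-1)%g == Om) && ('P^*%act Om a == Om).
Proof.
rewrite join_subG !cycle_subG andbC; congr (_ && _).
  apply/astabsP/eqP=> [N | Oinv x].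
    by apply/setP=> x; rewrite inE FinRing.zmodVgE -opp_permE -apermE N.
  by rewrite -{1}Oinv mem_invg FinRing.zmodVgE /= apermE opp_permE opprK.
by rewrite /= -astab1_set; apply/astab1P/eqP.
Qed.

(** Negation commutes with [a], so every group element is a power of negation followed by a power of
    [a]. *)
Lemma orbit_pm_group a x : a \in Aut [set: 'Z_n] ->
  orbit 'P (pm_group a) x = porbit a x :|: porbit a (- x).
Proof.
move=> Aa.
have comm : commute opp_perm a.
  apply/permP=> y; rewrite !permM !opp_permE.
  by rewrite (Aut_mulr (- y) Aa) (Aut_mulr y Aa) mulNr.
have cE : (pm_group a : {set _}) = (<[opp_perm]> * <[a]>)%g.
  by rewrite [LHS]joingC; apply: cent_joinEr; apply/cents_cycle.
apply/setP=> y; rewrite in_setU; apply/orbitP/orP.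
  rewrite cE => -[_ /mulsgP[_ _ /cycleP[i ->] /cycleP[k ->] ->] <-].
  have : (opp_perm ^+ i)%g x \in [set x; - x].
    elim: i => [|i]; first by rewrite perm1 !inE eqxx.
    by rewrite expgSr permM opp_permE !inE => /orP[] /eqP->; rewrite ?opprK eqxx ?orbT.
  by rewrite !inE /= apermE permM => /orP[] /eqP->; [left | right]; apply: mem_porbit.
case=> /porbitP[k ->].
  by exists (a ^+ k)%g => //; rewrite mem_gen // inE mem_cycle.
exists (opp_perm * a ^+ k)%g; last by rewrite /= apermE permM opp_permE.
by rewrite cE mem_mulg ?cycle_id ?mem_cycle.
Qed.

(** Nonzero coordinates of [x] cancel and zero ones impose nothing; hence orbit sizes depend only on
    the support. *)
Lemma mulr_eq_support x w w' :
  (x * w == x * w') = [forall (i | i \in support x), residue i w == residue i w'].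
Proof.
apply/eqP/forall_inP=> [e i | e].
  rewrite inE => xi; apply/eqP/(mulfI xi); by rewrite -!residueM e.
apply: residue_inj => i; rewrite !residueM.
have [-> | xi] := eqVneq (residue i x) 0; first by rewrite !mul0r.
by rewrite (eqP (e i _)) // inE.
Qed.

Lemma support_opp x : support (- x) = support x.
Proof. by apply/setP=> i; rewrite !inE residueN oppr_eq0. Qed.

(** * Orbit sizes for prescribed orders modulo each prime *)

Section OrbitSize.
Variables (d : 'I_l -> nat) (a : {perm 'Z_n}).
Hypotheses (p_odd : forall i, odd (p i)) (Aa : a \in Aut [set: 'Z_n]).
Hypothesis d_dvd : forall i, (d i %| (p i).-1)%N.
Hypothesis a_order : forall i, ((p i).-1 %/ d i)%N.-primitive_root (residue i (a 1)).

(** The [k]-th power of [a] fixes [x] exactly when [k] is a multiple of the order of [a 1] modulo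
    each prime in the support, that is, of their lcm. *)
Lemma card_porbit_Aut x : #|porbit a x| = L_J p d (support x).
Proof.
apply: card_porbit_order.
  rewrite /L_J; elim/big_ind: _ => // [m k m0 k0 | i _]; first by rewrite lcmn_gt0 m0.
  exact: prim_order_gt0 (a_order i).
move=> k; rewrite Aut_expr // -{2}[x]mulr1 mulr_eq_support.
apply/forall_inP/dvdn_biglcmP => e i /e.
  by rewrite residueX residue1 -(prim_order_dvd (a_order i)).
by rewrite residueX residue1 -(prim_order_dvd (a_order i)).
Qed.

Lemma residue_exprN1 i c :
  (residue i (a 1) ^+ c == -1) = (c * d i == (p i).-1 %/ 2 %[mod (p i).-1])%N.
Proof.
have p_gt1 := prime_gt1 (p_prime i).
apply: prim_root_exprN1 (a_order i).
- by rewrite prednK // prime_gt0.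
- by rewrite -ltnS prednK // prime_gt0.
- by rewrite divnK.
rewrite -(dvdn_pcharf (pchar_Fp (p_prime i))); apply/negP => /dvdn_leq => /(_ isT).
by have := p_odd i; case: (p i) p_gt1 => [|[|[|k]]].
Qed.

(** Membership means that one power of [a 1] equals -1 at every prime of the support, which is the
    condition in [alpha_J]. *)
Lemma opp_mem_porbit x : - x \in porbit a x <->
  exists c : int, forall i, i \in support x ->
    ((c * (d i)%:Z)%R = ((p i).-1 %/ 2)%:Z %[mod ((p i).-1)%:Z])%Z.
Proof.
split=> [/porbitP[c] | [c cP]].
  rewrite Aut_expr // -mulrN1 => /eqP; rewrite mulr_eq_support => /forall_inP e.
  exists c%:Z => i /e; rewrite residueN residue1 residueX eq_sym residue_exprN1 => /eqP h.
  by rewrite -PoszM !modz_nat h.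
(* Replace the integer c by a natural number congruent to it modulo every p_i - 1. *)
pose N := (\prod_i (p i).-1)%N.
have N_dvd i : ((p i).-1 %| N)%N by rewrite /N (bigD1 i) //= dvdn_mulr.
have N0 : (0 < N)%N.
  by rewrite prodn_gt0 // => i; rewrite -ltnS prednK ?prime_gt0 // prime_gt1.
have c0 : (0 <= (c %% N%:Z)%Z)%R by rewrite modz_ge0 // -lt0n.
pose k := `|(c %% N%:Z)%Z|%N.
have kE : k%:Z = (c %% N%:Z)%Z by rewrite /k gez0_abs.
apply/porbitP; exists k; apply/eqP.
rewrite Aut_expr // -mulrN1 mulr_eq_support; apply/forall_inP=> i /cP ci.
rewrite residueN residue1 residueX eq_sym residue_exprN1.
suff: ((k * d i)%N%:Z %% (p i).-1%:Z = ((p i).-1 %/ 2)%N%:Z %% (p i).-1%:Z)%Z.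
  by rewrite !modz_nat => -[->].
rewrite -ci PoszM kE -[LHS]modzMml -[RHS]modzMml; congr (modz (_ * _) _).
have /dvdnP[t Nt] := N_dvd i.
by rewrite [in RHS](divz_eq c N%:Z) {3}Nt PoszM mulrA modzMDl.
Qed.

(** The cycles of [x] and [- x] have equal length, and either coincide or are disjoint. *)
Lemma card_orbit_pm_group x :
  #|orbit 'P (pm_group a) x| = alpha_J p d (support x).
Proof.
rewrite orbit_pm_group // /alpha_J.
case: excluded_middle_informative => [/opp_mem_porbit | no_c] /=.
  by rewrite -eq_porbit_mem => /eqP->; rewrite setUid card_porbit_Aut.
rewrite cardsU !card_porbit_Aut support_opp addnn -mul2n.
rewrite (_ : _ :&: _ = set0) ?cards0 ?subn0 //; apply/setP=> y; rewrite !inE.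
apply/andP=> -[]; rewrite -!eq_porbit_mem => /eqP-> e; apply: no_c.
by apply/opp_mem_porbit; rewrite porbit_sym -eq_porbit_mem.
Qed.

End OrbitSize.

(** * Counting automorphisms and their action on connection sets *)

Lemma card_Aut_residues (Q : forall i, pred 'F_(p i)) :
    (forall i, ~~ Q i 0) ->
  #|[set a in Aut [set: 'Z_n] | [forall i, Q i (residue i (a 1))]]| = (\prod_i #|Q i|)%N.
Proof.
move=> Q0; rewrite -card_residues.
rewrite -(@card_in_imset _ _ (fun a : {perm 'Z_n} => a 1)); last first.
  move=> a b /setIdP[Aa _] /setIdP[Ab _] /= e.
  by apply/permP=> x; rewrite (Aut_mulr x Aa) (Aut_mulr x Ab) e.
apply: eq_card => u; rewrite inE; apply/imsetP/forallP=> [[a] | Qu].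
  by rewrite inE => /andP[_ /forallP Qa] ->.
(* As [Q i] excludes 0, [u] is nonzero at every prime, so multiplication by it is an
   automorphism. *)
have u0 i : residue i u != 0 by apply: contraNneq (Q0 i) => <-.
have mul_inj : injective (fun x : 'Z_n => x * u).
  move=> x y e; apply: residue_inj => i; apply: (mulIf (u0 i)).
  by rewrite -!residueM e.
have a1 : perm mul_inj 1 = u by rewrite permE mul1r.
exists (perm mul_inj) => //; rewrite inE a1; apply/andP; split; last exact/forallP.
rewrite inE; apply/andP; split; first by apply/subsetP => x; rewrite inE.
by apply/morphicP=> x y _ _; rewrite !permE !FinRing.zmodMgE mulrDl.
Qed.

Lemma card_Aut_Zn : #|Aut [set: 'Z_n]| = totient n.
Proof.
have cyc : cyclic [set: 'Z_n].
  apply/cyclicP; exists (1%R : 'Z_n); apply/setP=> x; rewrite inE; apply/esym/cycleP.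
  by exists x; rewrite FinRing.zmodXgE natr_Zp.
by rewrite card_Aut_cyclic // cardsT card_ord Zp_cast ?prod_prime_gt1.
Qed.

Lemma Aut_opp (a : {perm 'Z_n}) x : a \in Aut [set: 'Z_n] -> a (- x) = - a x.
Proof. by move=> Aa; rewrite (Aut_mulr (- x) Aa) (Aut_mulr x Aa) mulNr. Qed.

Lemma acts_cayley_sets k :
  [acts Aut [set: 'Z_n], on cayley_sets 'Z_n k | 'P^*].
Proof.
have act a (Om : {set 'Z_n}) : a \in Aut [set: 'Z_n] ->
    Om \in cayley_sets 'Z_n k -> 'P^*%act Om a \in cayley_sets 'Z_n k.
  move=> Aa; rewrite /= setactE !inE !generatesP => /and4P[/eqP Oinv /forallP gO O0 cO].
  have memO x : (a x \in [set 'P%act x a | x in Om]) = (x \in Om).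
    by rewrite mem_imset //; apply: perm_inj.
  apply/and4P; split.
  - apply/eqP/setP=> x; rewrite mem_invg FinRing.zmodVgE -[x](permKV a) -Aut_opp //.
    by rewrite !memO -{2}Oinv mem_invg FinRing.zmodVgE.
  - apply/forallP=> i; have /exists_inP[x Ox xi] := gO i.
    apply/exists_inP; exists (a x); rewrite ?memO //.
    by rewrite (Aut_mulr x Aa) residueM mulf_neq0 // residue_Aut_neq0.
  - rewrite [1%g](_ : _ = a 0); last by rewrite (Aut_mulr 0 Aa) mul0r.
    by rewrite memO.
  - by rewrite card_imset //; apply: perm_inj.
apply/subsetP=> a Aa; apply/astabsP=> Om; apply/idP/idP; last exact: act.
by move=> /(act _ _ (groupVr Aa)); rewrite actK.
Qed.

Lemma support_pm_group (a g : {perm 'Z_n}) x :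
  a \in Aut [set: 'Z_n] -> g \in pm_group a -> support (g x) = support x.
Proof.
move=> Aa Gg; have: g x \in orbit 'P (pm_group a) x by apply: mem_orbit.
rewrite orbit_pm_group // in_setU => /orP[] /porbitP[k ->];
  rewrite Aut_expr // support_mul_unit ?support_opp // => i;
  by rewrite residueX expf_neq0 // residue_Aut_neq0.
Qed.

(** Inclusion-exclusion over the primes at which all of [Om] vanishes: [Om] generates exactly when
    there are none. *)
Lemma sum_cayley_fixed (d : 'I_l -> nat) (a : {perm 'Z_n}) :
    (forall i, odd (p i)) -> a \in Aut [set: 'Z_n] ->
    (forall i, (d i %| (p i).-1)%N) ->
    (forall i, ((p i).-1 %/ d i)%N.-primitive_root (residue i (a 1))) ->
  \sum_(Om : {set 'Z_n} | [&& (Om^-1)%g == Om, <<Om>>%g == [set: 'Z_n],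
       (1%g : 'Z_n) \notin Om & 'P^*%act Om a == Om]) 'X^#|Om|
    = \sum_(I : {set 'I_l}) (-1) ^+ #|I| *: F_I p d I.
Proof.
move=> p_odd Aa d_dvd a_order.
pose inv (Om : {set 'Z_n}) := [acts pm_group a, on Om | 'P].
pose vanish (Om : {set 'Z_n}) := [set i | [forall (x | x \in Om), residue i x == 0]].
pose P (I J : {set 'I_l}) := (J != set0) && (J \subset ~: I).
have gen_vanish Om : (<<Om>>%g == [set: 'Z_n]) = (vanish Om == set0).
  rewrite generatesP; apply/forallP/eqP=> [gO | v0 i].
    apply/setP=> i; rewrite !inE; apply/negbTE/forall_inPn.
    by have /exists_inP[x] := gO i; exists x.
  have := in_set0 i; rewrite -v0 inE => /negbT/forall_inPn[x Ox xi].
  by apply/exists_inP; exists x.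
transitivity (\sum_(Om | inv Om && (0 \notin Om)) \sum_(I : {set 'I_l} | I \subset vanish Om)
                 (-1) ^+ #|I| *: 'X^#|Om| : {poly rat}).
  rewrite big_mkcond [RHS]big_mkcond; apply: eq_bigr => Om _.
  rewrite gen_vanish /inv pm_group_acts -scaler_suml sum_sign_subset.
  rewrite -[1%g]/(0 : 'Z_n); do !case: (_ == _) => //=; case: (_ \in _) => //=;
    by rewrite ?scale1r ?scale0r.
(* For fixed [I], the sets left are the invariant ones whose elements have nonempty support disjoint
   from [I]. *)
rewrite (exchange_big_dep predT) //=; apply: eq_bigr => I _.
rewrite -scaler_sumr; congr (_ *: _).
transitivity (\sum_(Om : {set 'Z_n} |
    (Om \subset [set x | P I (support x)]) && inv Om) 'X^#|Om| : {poly rat}).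
  apply: eq_bigl => Om; rewrite -andbA andbC; congr (_ && _).
  apply/andP/subsetP=> [[O0 /subsetP IO] x Ox | sO].
    rewrite inE /P support_eq0; apply/andP; split; first by apply: contraNneq O0 => <-.
    apply/subsetP=> i; rewrite !inE; apply: contraNN => /IO.
    by rewrite inE => /forall_inP/(_ x Ox).
  split; first by apply/negP=> /sO; rewrite inE /P support_eq0 eqxx.
  apply/subsetP=> i Ii; rewrite inE; apply/forall_inP=> x /sO.
  rewrite inE => /andP[_ /subsetP/(_ i)]; rewrite !inE Ii.
  by case: eqP => // _ /(_ isT).
rewrite sum_invariant_sets; last first.
  by apply/subsetP=> g Gg; apply/astabsP=> x; rewrite !inE /= apermE (support_pm_group _ Aa).
rewrite (prod_orbits (f := support) (alpha := alpha_J p d)).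
- by apply: eq_bigr => J _; rewrite card_support.
- by move=> g y Gg; rewrite /= apermE (support_pm_group _ Aa).
by move=> y; apply: card_orbit_pm_group.
Qed.

(** The Cauchy-Frobenius formula is applied in each degree; the degrees are then merged by summing
    over the fixed sets themselves. *)
Lemma Burnside_Psi_w :
  (totient n)%:R *: Psi_w 'Z_n
    = \sum_(a in Aut [set: 'Z_n])
        \sum_(Om : {set 'Z_n} | [&& (Om^-1)%g == Om, <<Om>>%g == [set: 'Z_n],
           (1%g : 'Z_n) \notin Om & 'P^*%act Om a == Om]) 'X^#|Om|.
Proof.
rewrite /Psi_w scaler_sumr.
transitivity (\sum_(1 <= k < #|'Z_n|) \sum_(a in Aut [set: 'Z_n])
    \sum_(Om | (Om \in cayley_sets 'Z_n k) && ('P^*%act Om a == Om)) 'X^k : {poly rat}).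
  apply: eq_bigr => k _; rewrite scalerA mulrC -natrM /aw -card_Aut_Zn.
  rewrite -(Frobenius_Cauchy (acts_cayley_sets k)) natr_sum scaler_suml.
  apply: eq_bigr => a _; rewrite scaler_nat -sumr_const; apply: eq_bigl => Om.
  by rewrite in_setI (sameP afix1P eqP).
rewrite exchange_big; apply: eq_bigr => a _.
rewrite (exchange_big_dep (fun Om : {set 'Z_n} => [&& (Om^-1)%g == Om,
  <<Om>>%g == [set: 'Z_n], (1%g : 'Z_n) \notin Om & 'P^*%act Om a == Om])) /=; last first.
  by move=> k Om _; rewrite inE -!andbA => /and5P[-> -> -> _ ->].
apply: eq_bigr => Om /and4P[Oinv Ogen O0 Oa].
rewrite (eq_bigl (fun k => k == #|Om|)) => [|k]; last first.
  by rewrite inE Oinv Ogen O0 Oa /= andbT eq_sym.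
(* The size lies in the range of degrees: a generating set is nonempty here, and a set without 0 is
   not the whole group. *)
rewrite big_nat1_eq card_gt0 ifT //; apply/andP; split.
  apply: contraTneq Ogen => ->; rewrite generatesP; apply/forallPn.
  by exists (Ordinal l_gt0); apply/exists_inPn => x; rewrite inE.
rewrite -cardsT proper_card // properEneq subsetT andbT.
by apply: contraNneq O0 => ->; rewrite inE.
Qed.

(** Each automorphism determines exactly one tuple [d], with [d i] equal to p_i - 1 divided by the
    order of [a 1] modulo [p i]; the totients count the automorphisms with a given tuple. *)
Lemma sum_Aut_by_orders (V : nmodType) (f : {perm 'Z_n} -> V) (g : {ffun 'I_l -> 'I_n} -> V) :
    (forall a (d : {ffun 'I_l -> 'I_n}), a \in Aut [set: 'Z_n] ->
       (forall i, (d i %| (p i).-1)%N) ->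
       (forall i, ((p i).-1 %/ d i)%N.-primitive_root (residue i (a 1))) -> f a = g d) ->
  \sum_(a in Aut [set: 'Z_n]) f a
    = \sum_(d : {ffun 'I_l -> 'I_n} | [forall i, ((d i : nat) %| (p i).-1)%N])
        g d *+ (\prod_(i < l) totient ((p i).-1 %/ d i)).
Proof.
move=> fg.
pose orders (a : {perm 'Z_n}) (d : {ffun 'I_l -> 'I_n}) :=
  [forall i, ((p i).-1 %/ d i)%N.-primitive_root (residue i (a 1))].
pose dvd (d : {ffun 'I_l -> 'I_n}) := [forall i, ((d i : nat) %| (p i).-1)%N].
have p1 i : (0 < (p i).-1)%N by rewrite -ltnS prednK ?prime_gt0 ?prime_gt1.
transitivity (\sum_(a in Aut [set: 'Z_n]) \sum_(d | dvd d && orders a d) g d).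
  apply: eq_bigr => a Aa.
  have /fin_all_exists[d0 d0P] i : exists e : 'I_n,
      (e %| (p i).-1)%N && ((p i).-1 %/ e)%N.-primitive_root (residue i (a 1)).
    have ui : residue i (a 1) ^+ (p i).-1 = 1.
      apply: (mulfI (residue_Aut_neq0 i Aa)).
      by rewrite mulr1 -exprS prednK ?prime_gt0 // -[X in _ ^+ X]card_Fp ?expf_card.
    have [m mP m_dvd] := prim_order_exists (p1 i) ui.
    (* Divisors of p_i - 1 lie below n, so indexing tuples by ['I_n] loses none. *)
    have e_lt : ((p i).-1 %/ m < n)%N.
      apply: leq_ltn_trans (leq_div _ _) _; rewrite prednK ?prime_gt0 //.
      by rewrite dvdn_leq ?prod_prime_gt0 ?prime_dvd_prod.
    exists (Ordinal e_lt) => /=; rewrite divnA // mulKn // mP andbT.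
    by rewrite -{2}(divnK m_dvd) dvdn_mulr.
  rewrite (big_pred1 [ffun i => d0 i]).
    by apply: fg => // i; have /andP[] := d0P i; rewrite ffunE.
  move=> d; apply/andP/eqP => [[/forallP dd /forallP od] | ->]; last first.
    by split; apply/forallP=> i; rewrite ffunE; have /andP[] := d0P i.
  apply/ffunP=> i; rewrite ffunE; apply/val_inj => /=.
  have /andP[d0d d0o] := d0P i.
  have eq_m : ((p i).-1 %/ d i = (p i).-1 %/ d0 i)%N.
    apply/eqP; rewrite eqn_dvd (prim_order_dvd (od i)) (prim_order_dvd d0o).
    by rewrite !prim_expr_order ?eqxx.
  apply/eqP; rewrite -(eqn_pmul2l (prim_order_gt0 (od i))) {2}eq_m.
  by rewrite !divnK.
rewrite (exchange_big_dep dvd) => [|a d _ /andP[]//] /=; apply: eq_bigr => d dd.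
rewrite (eq_bigl (fun a => a \in [set a in Aut [set: 'Z_n] | orders a d])) => [|a]; last first.
  by rewrite dd [RHS]in_set.
rewrite sumr_const; congr (_ *+ _).
rewrite (card_Aut_residues (Q := fun i => [pred y | ((p i).-1 %/ d i)%N.-primitive_root y])).
  apply: eq_bigr => i _; rewrite -(@card_prim_root 'F_(p i)) ?cardsE //.
  by rewrite card_Fp // dvdn_div // (forallP dd).
move=> i; apply/negP=> /= r0; have := prim_expr_order r0.
by rewrite expr0n eqn0Ngt (prim_order_gt0 r0) => /esym/eqP; rewrite oner_eq0.
Qed.

End SquarefreeResidues.

Theorem theorem4p6 (l : nat) (p : 'I_l -> nat) :
  (0 < l)%N ->
  (forall i, prime (p i)) ->
  (forall i, odd (p i)) ->
  injective p ->
  let n := (\prod_(i < l) p i)%N in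
  Psi_w 'Z_n =
  ((totient n)%:R^-1 *:
    \sum_(d : {ffun 'I_l -> 'I_n} | [forall i, ((d i : nat) %| (p i).-1)%N])
       (\prod_(i < l) totient ((p i).-1 %/ d i))%N%:R *:
       \sum_(I : {set 'I_l}) (-1) ^+ #|I| *: F_I p (fun i => (d i : nat)) I)%R.
Proof.
move=> l_gt0 p_prime p_odd p_inj n.
have phi_neq0 : (totient n)%:R != 0 :> rat.
  by rewrite Num.Theory.pnatr_eq0 -lt0n totient_gt0 prod_prime_gt0.
(* Once the denominator is cleared, the left side is the sum over automorphisms, ready to be grouped
   by orders. *)
apply: (scalerI phi_neq0); rewrite scalerA mulfV // scale1r Burnside_Psi_w //.
rewrite (sum_Aut_by_orders p_prime p_inj l_gt0 (g := fun d => \sum_(I : {set 'I_l})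
    (-1) ^+ #|I| *: F_I p (fun i => (d i : nat)) I)).
  by apply: eq_bigr => d _; rewrite scaler_nat.
by move=> a d Aa d_dvd a_order; apply: sum_cayley_fixed.
Qed.
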